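(* For an integer $j\geq 2$, define \[ \Delta_j^E:=\limsup_{n\to\infty}\frac{t_j(n)}{n}-\liminf_{n\to\infty}\frac{t_j(n)}{n}. \] Then for every integer $j\ge 2$, \[ \Delta_j^E\geq \frac{1}{24\cdot 3^j}. \] In particular, for every fixed integer $j\geq 2$, the limit $\lim_{n\to\infty} t_j(n)/n$ does not exist. Moreover, for every integer $j\ge 2$, \[ \frac{3}{2^{j+1}}-\frac{1}{2\cdot 3^j}\leq \liminf_{n\to\infty}\frac{t_j(n)}{n}\leq \limsup_{n\to\infty}\frac{t_j(n)}{n}\leq 2^{-(j-1)/2}. \] When $j=1$, the limit does exist, and \[ \lim_{n\to\infty}\frac{t_1(n)}{n}=\sum_{t=2}^{\infty}\frac{1}{t(t-1)}\left(1-\prod_{\substack{p\leq t\\ p\ \mathrm{prime}}}\left(1-\frac{1}{p}\right)\right)=\sum_{p\ \mathrm{prime}}\frac{1}{p(p-1)}\prod_{\substack{q<p\\ q\ \mathrm{prime}}}\left(1-\frac{1}{q}\right). \]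
   Context: For a positive integer $n$, define the iterated remainder sets \[ T_0(n):=\{1,2,\ldots,n-1\},\qquad T_{j+1}(n):=\{(-n)\bmod k : k\in T_j(n)\setminus\{0\}\}\quad (j\ge 0), \] where $(-n) \bmod k$ is the least nonnegative residue of $-n$ modulo $k$, and put $t_j(n):=|T_j(n)|$. *)

(* Defs.v *)
From HB Require Import structures.
From mathcomp Require Import all_boot all_order all_algebra finmap.
From mathcomp Require Import all_classical all_reals all_analysis.

Set Implicit Arguments.
Unset Strict Implicit.
Unset Printing Implicit Defensive.

Import Order.TTheory GRing.Theory Num.Theory numFieldNormedType.Exports.
Local Open Scope fset_scope.
Local Open Scope ring_scope.

(* The remainder is computed in [int], where [modz] is the least nonnegative
   residue for a nonzero modulus, and read back in [nat]. *)
Definition neg_mod (n k : nat) : nat := `|(- n%:Z %% k%:Z)%Z|%N.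

Fixpoint T (j n : nat) : {fset nat} :=
  if j is i.+1 then [fset neg_mod n k | k in T i n `\ 0%N]
  else [fset k in iota 1 n.-1].

Definition t (j n : nat) : nat := #|` T j n|.

(* The term of index 0 is 0 / 0 = 0; it plays no role in the limits. *)
Definition density (R : realType) (j : nat) : R^nat :=
  fun n => (t j n)%:R / n%:R.

Definition limsup_density (R : realType) (j : nat) : \bar R :=
  limn_esup (fun n => (density R j n)%:E).

Definition liminf_density (R : realType) (j : nat) : \bar R :=
  limn_einf (fun n => (density R j n)%:E).

Definition DeltaE (R : realType) (j : nat) : \bar R :=
  (limsup_density R j - liminf_density R j)%E.

Definition t1_summand (R : realType) (s : nat) : R :=
  1 / (s%:R * (s%:R - 1)) *
  (1 - \prod_(0 <= p < s.+1 | prime p) (1 - 1 / p%:R)).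

Definition t1_prime_summand (R : realType) (p : nat) : R :=
  1 / (p%:R * (p%:R - 1)) * \prod_(0 <= q < p | prime q) (1 - 1 / q%:R).

(* Main.v *)
Require Import Defs.
From HB Require Import structures.
From mathcomp Require Import all_boot all_order all_algebra finmap.
From mathcomp Require Import all_classical all_reals all_analysis.
From mathcomp Require Import zify ring lra.

Set Implicit Arguments.
Unset Strict Implicit.
Unset Printing Implicit Defensive.

Import Order.TTheory GRing.Theory Num.Theory numFieldNormedType.Exports.

(** Read an iterate backwards.  If [r = u k - n] is the remainder left by
    [k] with multiplier [u], so that [k = (r + n) / u] and [(u - 1) r < n], then
    [k] is larger than [r] but still satisfies [(u - 1) k < n].  Hence along a
    chain leading from [r] back to an element of [T 0 n] the multipliers never
    increase, every nonincreasing word of multipliers starting with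
    [u < n / r + 1] is possible, and each word of length [j] confines [r] to
    one residue class, [r = - d n] modulo the product [m] of the word, where
    [d] depends on the word alone ([classes], [hit]).  So on the window where
    the ceiling of [n / r] is [s], the set [T j n] is a finite union of residue
    classes indexed by the words in [2, ..., s] ([T_window]), and every density
    below is computed window by window.

    - Upper bound.  The classes of the window [s] have total density at most
      [s (s - 1) / 2 ^ (j + 1)] ([class_density]) and the window has length
      [n / (s (s - 1))], so each window contributes [n / 2 ^ (j + 1)] at most.
      Cutting at [s = S] leaves [1 / S + (S - 1) / 2 ^ (j + 1)], and [S] near
      [2 ^ ((j + 1) / 2)] is the best choice ([limsup_density_powR]).

    - Lower bound.  Above [n / 2] the only multiplier is 2; below [n / 2] the
      multipliers 2 and 3 are always available, and a recursion on [j] gives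
      density at least [2 / 2 ^ j - 1 / 3 ^ j] there ([hit3_count]).

    - Oscillation.  A union of residue classes of given moduli is smallest when
      all of them pass through 0, which happens when [n] is divisible by all
      the moduli; this is an observation of Rogers.  Here the two values of [n]
      that are compared differ at the prime 2 only: [n0] is divisible by a large
      [M], and [n1 = n0 + Q] by the odd part [Q] of [M] but not by 2.  The
      inequality is then checked on each fibre of the reduction modulo [Q],
      where the words of least 2-adic valuation decide ([fibre_le]).  On the
      window [s = 3] there is a definite gain, because for odd [n] two classes
      of moduli [2 * 3 ^ (j - 1)] and [4 * 3 ^ (j - 2)] become disjoint
      ([fibre_gain]).  Comparing blocks of [M] consecutive integers transfers
      this to [t j n0] and [t j n1] ([t_block_comparison]).

    - First iterate.  For [j = 1] the window [s] keeps the [r] such that [r + n]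
      has a prime factor at most [s], a proportion that does not depend on [n]
      ([hit1_coprime], [hit1_count]); the windows add up to the first series,
      and summation by parts turns it into the second one ([t1_abel]). *)

Local Open Scope nat_scope.

(** * Counting with periodic functions *)

Lemma sum_period_shift (f : nat -> nat) (P c : nat) :
  (forall x, f (x + P) = f x) ->
  \sum_(0 <= i < P) f (i + c) = \sum_(0 <= i < P) f i.
Proof.
move=> fP; elim: c => [|c <-]; first by apply: eq_bigr => i _; rewrite addn0.
have : \sum_(0 <= i < P.+1) f (i + c) = f c + \sum_(0 <= i < P) f (i.+1 + c).
  by rewrite big_nat_recl.
rewrite big_nat_recr //= (addnC P) fP addnC => /addnI ->.
by apply: eq_bigr => i _; rewrite addSnnS.
Qed.

Lemma sum_periods (f : nat -> nat) (P a q : nat) :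
  (forall x, f (x + P) = f x) ->
  \sum_(a <= x < a + q * P) f x = q * \sum_(0 <= x < P) f x.
Proof.
move=> fP; elim: q => [|q IH]; first by rewrite mul0n addn0 big_geq.
rewrite (@big_cat_nat _ _ _ (a + q * P)) ?leq_addr //=; last by rewrite mulSn; lia.
rewrite {}IH mulSn addnC; congr (_ + _).
rewrite -[X in index_iota X]add0n big_addn.
have -> : a + (P + q * P) - (a + q * P) = P by lia.
exact: sum_period_shift.
Qed.

(** The number of complete periods that fit in an interval is its length
    divided by the period, up to one unit. *)
Lemma sum_period_bounds (f : nat -> nat) (P a b : nat) :
  0 < P -> (forall x, f (x + P) = f x) -> a <= b ->
  (b - a) * (\sum_(0 <= x < P) f x)
    <= P * (\sum_(a <= x < b) f x + \sum_(0 <= x < P) f x) /\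
  P * \sum_(a <= x < b) f x <= (b - a + P) * \sum_(0 <= x < P) f x.
Proof.
move=> P0 fP ab; set c := \sum_(0 <= x < P) f x; set q := (b - a) %/ P.
have e1 : q * P <= b - a by exact: leq_divM.
have e2 : b - a < q.+1 * P by exact: ltn_ceil.
have lo : q * c <= \sum_(a <= x < b) f x.
  rewrite -(sum_periods a q fP) [leqRHS](@big_cat_nat _ _ _ (a + q * P)) /=;
    by [exact: leq_addr | lia].
have hi : \sum_(a <= x < b) f x <= q.+1 * c.
  rewrite -(sum_periods a q.+1 fP) [leqRHS](@big_cat_nat _ _ _ b) /=;
    by [exact: leq_addr | lia].
split; first by apply: leq_trans (_ : P * (q.+1 * c) <= _); nia.
by apply: leq_trans (_ : P * (q.+1 * c) <= _); nia.
Qed.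

Lemma dvdn_period (m M c x : nat) : m %| M -> (m %| x + M + c) = (m %| x + c).
Proof. by move=> mM; rewrite addnAC dvdn_addl. Qed.

Lemma sum_class (m M c : nat) : 0 < m -> m %| M ->
  \sum_(0 <= x < M) (m %| x + c : nat) = M %/ m.
Proof.
move=> m0 mM; rewrite -{1}(divnK mM) -[X in index_iota _ X]add0n.
rewrite (sum_periods (f := fun x => (m %| x + c : nat))) => [|x]; last first.
  by rewrite dvdn_period.
rewrite (sum_period_shift (f := fun x => (m %| x : nat))) => [|x]; last first.
  by rewrite dvdn_addl.
rewrite big_ltn // dvdn0 big_nat big1 ?addn0 ?muln1 // => i /andP[i0 im].
by rewrite gtnNdvd.
Qed.

Lemma sum_class2 (m1 m2 M c1 c2 : nat) :
  coprime m1 m2 -> 0 < m1 * m2 -> m1 * m2 %| M ->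
  \sum_(0 <= x < M) ((m1 %| x + c1) && (m2 %| x + c2) : nat) = M %/ (m1 * m2).
Proof.
move=> co m0 mM; rewrite -(sum_class (chinese m1 m2 c1 c2) m0 mM).
apply: eq_bigr => x _; rewrite Gauss_dvd //; congr (nat_of_bool (_ && _)).
  by rewrite /dvdn -modnDmr -(chinese_modl co c1 c2) modnDmr.
by rewrite /dvdn -modnDmr -(chinese_modr co c1 c2) modnDmr.
Qed.

(** Summation along the fibres of the reduction modulo [Q]. *)
Lemma sum_fibres (f : nat -> nat) (E Q : nat) :
  \sum_(0 <= x < E * Q) f x =
  \sum_(0 <= y < Q) \sum_(0 <= i < E) f (i * Q + y).
Proof.
rewrite big_nat_mul exchange_big_nat /=; apply: eq_bigr => i _.
rewrite -{1}[i * Q]add0n big_addn mulSn addnK.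
by apply: eq_bigr => y _; rewrite addnC.
Qed.

(** * The iterated remainders as unions of residue classes *)

(** A pair [(m, d)] stands for the residue class of [- d n] modulo [m]; the
    sign is moved to the other side, [m %| r + n * d], to stay in [nat].  The
    pairs are those of the nonincreasing words of length [j] in [2, ..., s],
    the first letter [u] being the last multiplier applied: the condition
    [u %| r + n] together with [m %| (r + n) / u + n * d] amounts to
    [u * m %| r + n * (1 + u * d)]. *)
Fixpoint classes (s j : nat) : seq (nat * nat) :=
  if j is i.+1 then
    [seq (u * c.1, 1 + u * c.2) | u <- iota 2 s.-1, c <- classes u i]
  else [:: (1, 0)].

Definition hit (s j n r : nat) : bool :=
  has (fun c => c.1 %| r + n * c.2) (classes s j).

Lemma mem_classesS (s j : nat) (c : nat * nat) :
  reflect (exists u c', [/\ 2 <= u <= s, c' \in classes u j &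
                            c = (u * c'.1, 1 + u * c'.2)])
          (c \in classes s j.+1).
Proof.
apply: (iffP (@allpairsPdep nat (fun=> (nat * nat)%type) _ _ _ _ _)) =>
  -[u [c' [h1 h2 ->]]]; exists u, c'.
  by split => //; move: h1; rewrite mem_iota; lia.
by split => //; rewrite mem_iota; lia.
Qed.

Lemma hit0 (s n r : nat) : hit s 0 n r.
Proof. by rewrite /hit /= dvd1n. Qed.

Lemma hitS (s j n r : nat) :
  reflect (exists u, [/\ 2 <= u <= s, u %| r + n & hit u j n ((r + n) %/ u)])
          (hit s j.+1 n r).
Proof.
have E u d : u * d + (r + n) = r + n * 1 + u * d by lia.
apply: (iffP hasP) => [[c /mem_classesS[u [c' [us c'in ->]]] /=]|[u [us ur]]].
  rewrite mulnDr muln1 addnA mulnCA => h.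
  have ur : u %| r + n.
    by move: (dvdn_trans (dvdn_mulr c'.1 (dvdnn u)) h); rewrite dvdn_addl ?dvdn_mulr.
  exists u; split => //; apply/hasP; exists c' => //.
  move: h; rewrite -{1}(divnK ur) [_ %/ u * u]mulnC -mulnDr dvdn_pmul2l //; lia.
case/hasP => c' c'in h; exists (u * c'.1, 1 + u * c'.2).
  by apply/mem_classesS; exists u, c'.
rewrite /= mulnDr muln1 addnA mulnCA -{1}(divnK ur) [_ %/ u * u]mulnC -mulnDr.
by rewrite dvdn_pmul2l //; lia.
Qed.

Lemma hit_mono (s s' j n r : nat) : s <= s' -> hit s j n r -> hit s' j n r.
Proof.
case: j => [|j] ss'; first by rewrite !hit0.
by case/hitS => u [us ur h]; apply/hitS; exists u; split => //; lia.
Qed.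

Lemma neg_modP (n k r : nat) : 0 < k ->
  reflect (r < k /\ k %| r + n) (neg_mod n k == r).
Proof.
move=> k0; have kE : (Posz k != 0)%R by lia.
have [e0 e1] : (neg_mod n k < k) /\ (k %| neg_mod n k + n).
  rewrite /neg_mod; have := modz_ge0 (- Posz n)%R kE.
  have := ltz_mod (- Posz n)%R kE; have := divz_eq (- Posz n)%R (Posz k).
  set q := (_ %/ _)%Z; set m := (_ %% _)%Z => e l g; split; first by lia.
  rewrite -[k]/(`|Posz k|%N) -[X in _ %| X]/(`|Posz (`|m|%N + n)|%N) -dvdzE.
  by apply/dvdzP; exists (- q)%R; lia.
apply: (iffP eqP) => [<- //|[rk rd]].
have : neg_mod n k + n == r + n %[mod k].
  by move: e1 rd; rewrite /dvdn => /eqP -> /eqP ->.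
by rewrite eqn_modDr !modn_small // => /eqP.
Qed.

Lemma mem_T0 (n k : nat) : (k \in T 0 n) = (0 < k < n).
Proof. rewrite /T in_fset_ /=. rewrite mem_iota; lia. Qed.

Lemma mem_TS (j n r : nat) :
  reflect (exists k, [/\ 0 < k, k \in T j n, r < k & k %| r + n])
          (r \in T j.+1 n).
Proof.
rewrite [T _ _]/=; apply: (iffP (imfsetP _ _ _ _)) => /= [[k]|[k [k0 kT rk kd]]].
  rewrite !inE => /andP[k0 kT] rE; have k0' : 0 < k by lia.
  by have /(neg_modP _ _ k0')[? ?] := etrans (eq_sym _ _) (introT eqP rE); exists k.
exists k; first by rewrite !inE kT; lia.
by apply/esym/eqP/neg_modP.
Qed.

Lemma ltn_T (j n r : nat) : r \in T j n -> r < n.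
Proof.
elim: j r => [|j IH] r; first by rewrite mem_T0 => /andP[].
by case/mem_TS => k [_ /IH kn rk _]; exact: ltn_trans kn.
Qed.

(** If [r < n / (s - 1)] and [u <= s] divides [r + n], the preimage
    [(r + n) / u] lies above [r] and still below [n / (u - 1)], so that the
    induction continues with multipliers at most [u]. *)
Lemma hit_T (s j n r : nat) :
  0 < n -> 1 < s -> s.-1 * r < n -> 0 < r + j -> hit s j n r -> r \in T j n.
Proof.
move=> n0; elim: j s r => [|j IH] s r s1 sr rj.
  by rewrite mem_T0 => _; nia.
case/hitS => u [us ur]; set k := _ %/ u => h.
have kE : k * u = r + n by exact: divnK.
have usr : u.-1 * r < n by nia.
apply/mem_TS; exists k; split; [nia| |nia|by rewrite -kE dvdn_mulr].
by apply: IH h; nia.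
Qed.

(** Conversely the multiplier [u] leading from [k] to [r = u k - n] is the
    ceiling of [n / k], and [k > r]: going back, multipliers decrease. *)
Lemma T_hit (s j n r : nat) : r \in T j n -> n <= s * r -> hit s j n r.
Proof.
elim: j s r => [|j IH] s r; first by rewrite hit0.
case/mem_TS => k [k0 kT rk /dvdnP[u uE]] nsr.
have kn := ltn_T kT; apply/hitS; exists u; split; [nia|by rewrite uE dvdn_mulr|].
rewrite uE mulKn; first by apply: IH => //; lia.
by case: u uE => //; lia.
Qed.

Lemma t_sum (j n : nat) : t j n = \sum_(0 <= r < n) (r \in T j n : nat).
Proof.
have TE : T j n = [fset r in [seq r <- iota 0 n | r \in T j n]]%fset.
  apply/fsetP => r; rewrite in_fset_ /= mem_filter mem_iota add0n.
  by apply/idP/andP => [rT|[]//]; rewrite (ltn_T rT).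
rewrite /t {1}TE card_fseq undup_id ?filter_uniq ?iota_uniq // size_filter.
by rewrite -sum1_count /index_iota subn0 big_mkcond.
Qed.

Lemma t_le (j n : nat) : t j n <= n.
Proof.
rewrite t_sum -[leqRHS]subn0 -[leqRHS]muln1 -sum_nat_const_nat leq_sum // => r _.
exact: leq_b1.
Qed.

(** The ceiling of [n / s]. *)
Definition cut (n s : nat) : nat := (n + s.-1) %/ s.

Lemma cutP (n s r : nat) : 0 < s -> (cut n s <= r) = (n <= s * r).
Proof. by move=> s0; rewrite /cut -ltnS ltn_divLR // mulSn mulnC; lia. Qed.

Lemma cut_bounds (n s : nat) : 0 < s -> n <= s * cut n s < n + s.
Proof.
move=> s0; rewrite -cutP // leqnn /= /cut mulnC.
by apply: leq_ltn_trans (leq_divM _ _) _; lia.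
Qed.

Lemma leq_cut (n s s' : nat) : 0 < s -> s <= s' -> cut n s' <= cut n s.
Proof.
by move=> s0 ss'; rewrite cutP; [case/andP: (cut_bounds n s0); nia | lia].
Qed.

Lemma cut1 n : cut n 1 = n.
Proof. by rewrite /cut divn1 addn0. Qed.

(** The hypotheses of [T_hit] and [hit_T] hold together exactly when [s] is the
    ceiling of [n / r]. *)
Lemma T_window (s j n r : nat) : 1 < s -> 0 < n -> 0 < r + j ->
  cut n s <= r < cut n s.-1 -> (r \in T j n) = hit s j n r.
Proof.
move=> s1 n0 rj; rewrite cutP ?(ltnNge r) ?cutP; [|lia|lia].
move=> /andP[nr rn]; apply/idP/idP => [rT|]; first exact: T_hit.
by apply: hit_T => //; lia.
Qed.

Lemma t_cut (j n S : nat) : 0 < n -> 0 < S -> 0 < j ->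
  t j n = \sum_(0 <= r < cut n S) (r \in T j n : nat) +
    \sum_(2 <= s < S.+1) \sum_(cut n s <= r < cut n s.-1) (hit s j n r : nat).
Proof.
move=> n0 S0 j0; elim: S S0 => // -[|S] IH _.
  by rewrite cut1 [X in _ + X]big_geq // addn0 t_sum.
rewrite IH // [in RHS]big_nat_recr //= addnCA addnC; congr (_ + _).
rewrite (@big_cat_nat _ _ _ (cut n S.+2)) ?leq_cut //=; congr (_ + _).
by apply: eq_big_nat => r rI; rewrite (@T_window S.+2) //; lia.
Qed.

Lemma classes_dvd (L s j : nat) (c : nat * nat) :
  (forall u, 2 <= u <= s -> u %| L) -> c \in classes s j -> c.1 %| L ^ j.
Proof.
elim: j s c => [|j IH] s c sL; first by rewrite inE => /eqP ->.
case/mem_classesS => u [c' [us c'in ->]] /=; rewrite expnS dvdn_mul ?sL //.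
by apply: IH c'in => v vu; apply: sL; lia.
Qed.

Lemma classes_gt0 (s j : nat) (c : nat * nat) : c \in classes s j -> 0 < c.1.
Proof.
elim: j s c => [|j IH] s c; first by rewrite inE => /eqP ->.
by case/mem_classesS => u [c' [us /IH c'in ->]] /=; rewrite muln_gt0 c'in; lia.
Qed.

Lemma hit_period (L s j n r : nat) : (forall u, 2 <= u <= s -> u %| L) ->
  hit s j n (r + L ^ j) = hit s j n r.
Proof.
move=> sL; apply: eq_in_has => c cin.
by rewrite dvdn_period // (classes_dvd sL cin).
Qed.

Local Open Scope ring_scope.

(** * The upper bound *)

(** The sum is the complete homogeneous symmetric polynomial of degree [j] in
    [1/2, ..., 1/s].  The words starting with [u] contribute [1 / u] times the
    sum for [u] and [j - 1], hence at most [(u - 1) / 2 ^ j], and these bounds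
    add up to [1 + ... + (s - 1)] over [2 ^ j]. *)
Lemma class_density (R : realFieldType) (s j : nat) : (1 < s)%N ->
  \sum_(c <- classes s j) c.1%:R^-1 <= s%:R * (s%:R - 1) / 2 ^+ j.+1 :> R.
Proof.
have gauss k : \sum_(2 <= u < k.+2) (u%:R - 1) = k.+1%:R * (k.+1%:R - 1) / 2 :> R.
  elim: k => [|k IH]; first by rewrite big_geq // subrr mulr0 mul0r.
  by rewrite big_nat_recr //= IH -[k.+2]addn1 natrD; field.
elim: j s => [|j IH] s s1.
  have : (2 : R) <= s%:R by rewrite ler_nat.
  by rewrite /= big_seq1 invr1 expr1; nra.
rewrite [classes _ _]/= big_allpairs_dep /=.
have -> : iota 2 s.-1 = index_iota 2 s.+1 by rewrite /index_iota; congr iota; lia.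
apply: le_trans (_ : \sum_(2 <= u < s.+1) (u%:R - 1) / 2 ^+ j.+1 <= _).
  rewrite !big_nat; apply: ler_sum => u /andP[u2 us].
  have u0 : (0 : R) < u%:R by rewrite ltr0n; lia.
  under eq_bigr do rewrite natrM invfM.
  by rewrite -mulr_sumr ler_pdivrMl // mulrA IH.
rewrite -mulr_suml; case: s s1 => // s _; rewrite gauss [in leRHS]exprS.
by rewrite invfM mulrA.
Qed.

Lemma sum_class_le (R : realFieldType) (m c a b : nat) : (0 < m)%N -> (a <= b)%N ->
  (\sum_(a <= x < b) (m %| x + c : nat))%:R <= (b%:R - a%:R) / m%:R + 1 :> R.
Proof.
move=> m0 ab; have m0' : (0 : R) < m%:R by rewrite ltr0n.
have [|_] := @sum_period_bounds (fun x => (m %| x + c : nat)) m a b m0 _ ab.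
  by move=> x; rewrite dvdn_period.
rewrite sum_class // divnn m0 muln1 -(ler_nat R) natrM natrD natrB // => h.
by rewrite -(ler_pM2l m0') mulrDr mulr1 mulrCA mulfV ?mulr1 // gt_eqF.
Qed.

Lemma hit_sum_le (R : realFieldType) (s j n a b : nat) : (a <= b)%N ->
  (\sum_(a <= r < b) (hit s j n r : nat))%:R <=
  (b%:R - a%:R) * (\sum_(c <- classes s j) c.1%:R^-1) + (size (classes s j))%:R :> R.
Proof.
move=> ab; have hc r : (hit s j n r <= \sum_(c <- classes s j) (c.1 %| r + n * c.2))%N.
  rewrite /hit; elim: (classes s j) => [|c C IH]; first by rewrite big_nil.
  by rewrite big_cons /=; case: (c.1 %| _)%N => //=; rewrite add0n.
apply: (@le_trans _ _ (\sum_(c <- classes s j)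
    \sum_(a <= r < b) (c.1 %| r + n * c.2 : nat))%N%:R).
  by rewrite ler_nat exchange_big /=; apply: leq_sum => r _; exact: hc.
rewrite natr_sum mulr_sumr -sum1_size natr_sum -big_split /= !big_seq.
by apply: ler_sum => c cin; rewrite sum_class_le // (classes_gt0 cin).
Qed.

Lemma cut_real (R : realFieldType) (n s : nat) : (0 < s)%N ->
  n%:R / s%:R <= (cut n s)%:R :> R /\ (cut n s)%:R <= n%:R / s%:R + 1 :> R.
Proof.
move=> s0; have s0' : (0 : R) < s%:R by rewrite ltr0n.
have /andP[lo hi] := cut_bounds n s0.
rewrite ler_pdivrMr // mulrC -natrM ler_nat; split => //.
rewrite -(ler_pM2l s0') mulrDr mulrCA mulfV ?gt_eqF // !mulr1.
by rewrite -natrM -natrD ler_nat ltnW.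
Qed.

(** Nothing is claimed below [n / S]; each of the [S - 1] windows above it
    contributes at most [n / 2 ^ j.+1] up to a bounded error, since the factor
    [s (s - 1)] of [class_density] cancels the length [n / (s (s - 1))] of the
    window. *)
Lemma t_upper (R : realFieldType) (j S : nat) : (0 < j)%N -> (0 < S)%N ->
  exists C : R, forall n, (0 < n)%N ->
    (t j n)%:R <= n%:R * (S%:R^-1 + (S%:R - 1) / 2 ^+ j.+1) + C.
Proof.
move=> j0 S0; pose h s : R := \sum_(c <- classes s j) c.1%:R^-1.
exists (1 + \sum_(2 <= s < S.+1) (h s + (size (classes s j))%:R)) => n n0.
rewrite (t_cut n0 S0 j0) natrD mulrDr [leRHS]addrA -[leRHS]addrA addrACA lerD //.
  apply: le_trans (cut_real R n S0).2; rewrite ler_nat.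
  rewrite -[leqRHS]subn0 -[leqRHS]muln1 -sum_nat_const_nat leq_sum // => r _.
  exact: leq_b1.
have -> : (S%:R - 1) / 2 ^+ j.+1 = \sum_(2 <= s < S.+1) (2 ^+ j.+1)^-1 :> R.
  by rewrite sumr_const_nat -[RHS]mulr_natl subSS natrB.
rewrite mulr_sumr -big_split natr_sum !big_nat /=.
apply: ler_sum => s /andP[s1 sS].
apply: le_trans (hit_sum_le _ _ _ _ _) _; first by rewrite leq_cut //; lia.
rewrite [leRHS]addrA lerD2r -/(h s).
have s0 : (0 < s)%N by lia.
have sp0 : (0 < s.-1)%N by lia.
have h0 : 0 <= h s by apply: sumr_ge0 => c _; rewrite invr_ge0.
have := (cut_real R n s0).1; have := (cut_real R n sp0).2.
have spE : s.-1%:R = s%:R - 1 :> R by rewrite -subn1 natrB.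
have s2 : (2 : R) <= s%:R by rewrite ler_nat.
rewrite spE => hi lo; set x := (cut n s.-1)%:R - _.
have xle : x <= n%:R / (s%:R * (s%:R - 1)) + 1.
  have -> : n%:R / (s%:R * (s%:R - 1)) = n%:R / (s%:R - 1) - n%:R / s%:R :> R.
    by field; rewrite !gt_eqF //; lra.
  by rewrite /x; lra.
apply: le_trans (ler_wpM2r h0 xle) _; rewrite mulrDl mul1r lerD2r.
rewrite -mulrA ler_wpM2l // ler_pdivrMl; last by nra.
exact: class_density.
Qed.

(** * The lower bound *)

Local Open Scope nat_scope.

Lemma classes2 (j : nat) : exists d, (2 ^ j, d) \in classes 2 j.
Proof.
elim: j => [|j [d din]]; first by exists 0.
by exists (1 + 2 * d); apply/mem_classesS; exists 2, (2 ^ j, d); rewrite expnS.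
Qed.

Lemma hit_class (s j n r : nat) (c : nat * nat) :
  c \in classes s j -> c.1 %| r + n * c.2 -> hit s j n r.
Proof. by move=> cin h; apply/hasP; exists c. Qed.

Lemma hit3_period (j n r : nat) : hit 3 j n (r + 6 ^ j) = hit 3 j n r.
Proof. by apply: hit_period => -[|[|[|[|u]]]]. Qed.

(** Either [r + n] is a multiple of 3, and one descends to [(r + n) / 3], or
    it is not, and one keeps the class given by [j.+1] multipliers 2; the two
    cases being exclusive, the densities [b j] satisfy
    [b j.+1 >= b j / 3 + (2 / 3) / 2 ^ j.+1], which is solved by
    [b j = 2 / 2 ^ j - 1 / 3 ^ j]. *)
Lemma hit3_count (j n : nat) :
  2 * 3 ^ j <= \sum_(0 <= r < 6 ^ j) (hit 3 j n r : nat) + 2 ^ j.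
Proof.
elim: j => [|j IH]; first by rewrite big_nat1 hit0.
have [d din] := classes2 j.+1.
pose g u : nat := (3 %| u) && hit 3 j n (u %/ 3).
pose A r := 2 ^ j.+1 %| r + n * d.
(* When both alternatives occur at once, only one of them may be counted. *)
have pw r : g (r + n) + A r <= hit 3 j.+1 n r + (A r && (3 %| r + n)).
  have hA : A r -> hit 3 j.+1 n r.
    by move=> h; apply: (hit_mono (s := 2)) => //; exact: (hit_class din).
  have hg : (3 %| r + n) && hit 3 j n ((r + n) %/ 3) -> hit 3 j.+1 n r.
    by case/andP => ? ?; apply/hitS; exists 3.
  move: hA hg; rewrite /g; case: (A r); case: (3 %| r + n); case: (hit 3 j n _);
    case: (hit 3 j.+1 n r) => //= a b; by [have := a isT | have := b isT].
have sg : 2 * \sum_(0 <= r < 6 ^ j) (hit 3 j n r : nat)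
    <= \sum_(0 <= r < 6 ^ j.+1) g (r + n).
  rewrite sum_period_shift => [|x]; last first.
    rewrite /g expnS (_ : 6 * 6 ^ j = (6 ^ j + 6 ^ j) * 3); last by lia.
    by rewrite dvdn_addl ?dvdn_mull // addnC divnMDl // addnC addnA !hit3_period.
  rewrite expnS (_ : 6 * 6 ^ j = (2 * 6 ^ j) * 3); last by lia.
  rewrite sum_fibres [leqRHS]big_ltn //=; apply: leq_trans (leq_addr _ _).
  rewrite -[X in index_iota 0 X]add0n -(sum_periods 0 2 (f := hit 3 j n)) => [|x].
    by apply: leq_sum => i _; rewrite /g addn0 dvdn_mull // mulnK.
  by rewrite hit3_period.
have c23 : coprime (2 ^ j.+1) 3 by rewrite coprimeXl.
have [sA sA3] : \sum_(0 <= r < 6 ^ j.+1) (A r : nat) = 3 ^ j.+1 /\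
    \sum_(0 <= r < 6 ^ j.+1) (A r && (3 %| r + n) : nat) = 3 ^ j.
  have E6 : 6 ^ j.+1 = 3 ^ j.+1 * 2 ^ j.+1 by rewrite -expnMn.
  split; first by rewrite sum_class ?E6 ?expn_gt0 ?dvdn_mull // mulnK ?expn_gt0.
  have E7 : 6 ^ j.+1 = 3 ^ j * (2 ^ j.+1 * 3) by rewrite E6 !expnS; lia.
  have m0 : 0 < 2 ^ j.+1 * 3 by rewrite muln_gt0 expn_gt0.
  by rewrite sum_class2 // E7 ?mulnK // dvdn_mull.
have : \sum_(0 <= r < 6 ^ j.+1) (g (r + n) + A r) <=
    \sum_(0 <= r < 6 ^ j.+1) (hit 3 j.+1 n r + (A r && (3 %| r + n))).
  by apply: leq_sum => r _; exact: pw.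
rewrite !big_split /= sA sA3; move: sg IH.
set G := \sum_(0 <= r < 6 ^ j.+1) g _; set H := \sum_(0 <= r < 6 ^ j.+1) _.
by rewrite !expnS; lia.
Qed.

Local Open Scope ring_scope.

(** Above [n / 2] only the multiplier 2 is possible, and a single class modulo
    [2 ^ j] remains; below [n / 2] the multipliers 2 and 3 are possible
    throughout. *)
Lemma t_lower (R : realFieldType) (j : nat) : (0 < j)%N ->
  exists C : R, forall n, (0 < n)%N ->
    n%:R * (3 / 2 ^+ j.+1 - 1 / (2 * 3 ^+ j)) - C <= (t j n)%:R.
Proof.
move=> j0; exists (6 ^+ j + 2) => n n0.
have [c2lo c2hi] := cut_real R n (isT : 0 < 2)%N.
have cn : (cut n 2 <= n)%N by rewrite -[leqRHS]cut1 leq_cut.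
rewrite (@t_cut j n 2) // natrD big_nat1 cut1.
have p2 : (0 : R) < 2 ^+ j by rewrite exprn_gt0.
have p3 : (0 : R) < 3 ^+ j by rewrite exprn_gt0.
have E6 : (6 : R) ^+ j = 2 ^+ j * 3 ^+ j by rewrite -exprMn -natrM.
have low : n%:R / 2 * (2 / 2 ^+ j - 1 / 3 ^+ j) - 6 ^+ j <=
    (\sum_(0 <= r < cut n 2) (r \in T j n : nat))%:R :> R.
  have le1 : (\sum_(0 <= r < cut n 2) (hit 3 j n r : nat) <=
              \sum_(0 <= r < cut n 2) (r \in T j n : nat))%N.
    rewrite !big_nat; apply: leq_sum => r /andP[_]; rewrite ltnNge cutP // => rn.
    have := @hit_T 3 j n r n0 isT; case: (hit 3 j n r) => // -> //; lia.
  have [lo _] := @sum_period_bounds (fun r => hit 3 j n r : nat) (6 ^ j) 0 (cut n 2)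
    (expn_gt0 6 j) (fun r => congr1 nat_of_bool (hit3_period j n r)) (leq0n _).
  have := hit3_count j n; move: lo le1; set c := (\sum_(0 <= x < 6 ^ j) _)%N.
  set X := (\sum_(0 <= x < _) _)%N; set Y := (\sum_(0 <= x < _) _)%N.
  have cP : (c <= 6 ^ j)%N.
    rewrite -[leqRHS]subn0 -[leqRHS]muln1 -sum_nat_const_nat leq_sum // => r _.
    exact: leq_b1.
  move: cP; rewrite subn0 -!(ler_nat R) !(natrM, natrD, natrX) E6 => cP lo le1 cnt.
  rewrite -(ler_pM2l (mulr_gt0 p2 p3)).
  have -> : 2 ^+ j * 3 ^+ j * (n%:R / 2 * (2 / 2 ^+ j - 1 / 3 ^+ j) - 2 ^+ j * 3 ^+ j)
     = n%:R / 2 * (2 * 3 ^+ j - 2 ^+ j) - (2 ^+ j * 3 ^+ j) ^+ 2 :> R.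
    by field; rewrite !gt_eqF.
  have n2 : 0 <= n%:R / 2 :> R by rewrite divr_ge0.
  have q0 : (0 : R) < 2 ^+ j * 3 ^+ j by rewrite mulr_gt0.
  have c0 : (0 : R) <= c%:R by [].
  have := ler_wpM2l n2 (_ : 2 * 3 ^+ j - 2 ^+ j <= c%:R); rewrite lerBlDr => /(_ cnt).
  have := ler_wpM2r c0 c2lo; have := ler_wpM2l (ltW q0) cP; have := ler_wpM2l (ltW q0) le1.
  by rewrite expr2; lra.
have [d din] := classes2 j.
have high : (n%:R / 2 - 1) / 2 ^+ j - 1 <=
    (\sum_(cut n 2 <= r < n) (hit 2 j n r : nat))%:R :> R.
  have le1 : (\sum_(cut n 2 <= r < n) (2 ^ j %| r + n * d)%N <=
              \sum_(cut n 2 <= r < n) (hit 2 j n r : nat))%N.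
    apply: leq_sum => r _; have := @hit_class 2 j n r _ din.
    by case: (_ %| _)%N => // ->.
  have [|lo _] := @sum_period_bounds (fun r => (2 ^ j %| r + n * d)%N : nat) (2 ^ j)
    (cut n 2) n (expn_gt0 2 j) _ cn.
    by move=> x; rewrite dvdn_period.
  move: lo; rewrite sum_class ?expn_gt0 // divnn expn_gt0 /= muln1.
  move: le1; rewrite -!(ler_nat R) !(natrM, natrD, natrX) natrB // => le1 lo.
  rewrite -(ler_pM2l p2) mulrBr mulrCA mulfV ?gt_eqF // !mulr1.
  by have := ler_wpM2l (ltW p2) le1; lra.
have p2' : (2 ^+ j)^-1 <= 1 :> R by rewrite invf_le1 // exprn_ege1 // ler1n.
apply: le_trans (lerD low high); rewrite exprS !invfM.
by move: p2'; set a := 2 ^- j; set b := 3 ^- j; lra.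
Qed.

(** * Oscillation *)

Local Open Scope nat_scope.

(** As [Q] divides [n], the translation by [n * d] preserves each fibre of the
    reduction modulo [Q]. *)
Lemma sum_fibre_shift (m E Q y n d : nat) : m %| E * Q -> Q %| n ->
  \sum_(0 <= i < E) (m %| i * Q + y + n * d : nat) =
  \sum_(0 <= i < E) (m %| i * Q + y : nat).
Proof.
move=> mEQ /dvdnP[q ->].
rewrite -(sum_period_shift (P := E) (f := fun i => (m %| i * Q + y : nat)) (q * d)).
  by apply: eq_bigr => i _; rewrite (_ : i * Q + y + _ = (i + q * d) * Q + y); lia.
by move=> x; rewrite mulnDl dvdn_period.
Qed.

Lemma min_seq (A : eqType) (f : A -> nat) (C : seq A) (x : A) : x \in C ->
  exists2 y, y \in C & forall z, z \in C -> f y <= f z.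
Proof.
elim: C x => [//|a C IH] x _; case: C IH => [|b C] IH.
  by exists a => [|z]; rewrite ?inE // => /eqP ->.
have [y yC ymin] := IH b (mem_head b C).
have [fle|flt] := leqP (f a) (f y).
  exists a => [|z]; first exact: mem_head.
  by rewrite inE => /orP[/eqP -> //|/ymin]; exact: leq_trans.
exists y => [|z]; first by rewrite inE yC orbT.
by rewrite inE => /orP[/eqP ->|/ymin //]; exact: ltnW.
Qed.

Lemma dvdn_2parts (m r : nat) : 0 < m ->
  (m %| r) = (m`_2 %| r) && (m`_2^' %| r).
Proof. by move=> m0; rewrite -{1}(partnC 2 m0) Gauss_dvd // coprime_partC. Qed.

(** Fix the residue [y] of [r] modulo the odd part [Q] of [M].  Only the
    classes whose odd part divides [y] can meet this fibre; among them one of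
    least 2-adic valuation contains all the others when every class passes
    through 0, and the union for [n] still contains a translate of it. *)
Lemma fibre_le (s j M n y : nat) : 0 < M ->
  (forall c, c \in classes s j -> c.1 %| M) -> M`_2^' %| n ->
  \sum_(0 <= i < M`_2) (hit s j 0 (i * M`_2^' + y) : nat) <=
  \sum_(0 <= i < M`_2) (hit s j n (i * M`_2^' + y) : nat).
Proof.
move=> M0 cM Qn; set Q := M`_2^'; set E := M`_2.
have EQ : E * Q = M by exact: partnC.
have oddQ c : c \in classes s j -> c.1`_2^' %| Q.
  by move=> cin; apply: partn_dvd => //; exact: cM.
have oddP c i : c \in classes s j -> c.1 %| i * Q + y -> c.1`_2^' %| y.
  move=> cin; rewrite dvdn_2parts ?(classes_gt0 cin) // => /andP[_].
  by rewrite dvdn_addr // dvdn_mull // oddQ.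
pose D := [seq c <- classes s j | c.1`_2^' %| y].
have [[c0 c0D]|D0] : (exists c, c \in D) \/ forall c, c \notin D.
- by case: D => [|c D]; [right | left; exists c; exact: mem_head].
- have [c] := min_seq (fun c => logn 2 c.1) c0D.
  rewrite mem_filter => /andP[cy cin] cmin.
  apply: (@leq_trans (\sum_(0 <= i < E) (c.1 %| i * Q + y : nat))); last first.
    rewrite -(sum_fibre_shift y c.2 _ Qn) ?EQ ?cM //.
    apply: leq_sum => i _; have := @hit_class s j n (i * Q + y) c cin.
    by case: (c.1 %| _) => // ->.
  apply: leq_sum => i _; case hi: (hit s j 0 _) => //.
  case/hasP: hi => c' c'in; rewrite mul0n addn0 => h.
  suff -> : c.1 %| i * Q + y by [].
  have c'y := oddP _ _ c'in h.
  rewrite dvdn_2parts ?(classes_gt0 cin) //; apply/andP; split; last first.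
    by rewrite dvdn_add // dvdn_mull // oddQ.
  move: h; rewrite dvdn_2parts ?(classes_gt0 c'in) // => /andP[h _].
  by apply: dvdn_trans h; rewrite !p_part dvdn_exp2l // cmin // mem_filter c'y.
- rewrite big1 // => i _; case hi: (hit s j 0 _) => //.
  case/hasP: hi => c cin; rewrite mul0n addn0 => h.
  by have := D0 c; rewrite mem_filter cin (oddP _ _ cin h).
Qed.

(** Consequently, if [3 ^ j] does not divide [r], every class through 0 that
    contains [r] consists of even numbers. *)
Lemma class3_dvd (j : nat) (c : nat * nat) : c \in classes 3 j ->
  (3 ^ j %| c.1) || (2 %| c.1).
Proof.
elim: j c => [|j IH] c; first by rewrite inE => /eqP ->.
case/mem_classesS => u [c' [u23 c'in ->]] /=.
have [->|uE] : u = 2 \/ u = 3 by lia.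
  by rewrite [2 %| _]dvdn_mulr ?orbT.
rewrite uE in c'in *; have /orP[h|h] := IH _ c'in.
  by rewrite expnS dvdn_pmul2l // h.
by rewrite [2 %| _]dvdn_mull ?orbT.
Qed.

(** The words are [3, ..., 3, 2] and [3, ..., 3, 2, 2].  A letter 3 in front
    changes [d] into [1 + 3 * d], hence flips both parities. *)
Lemma class3_pair (j : nat) : exists d d', [/\ (2 * 3 ^ j.+1, d) \in classes 3 j.+2,
  (4 * 3 ^ j, d') \in classes 3 j.+2 & odd d != odd d'].
Proof.
elim: j => [|j [d [d' [din d'in dd']]]]; first by exists 4, 3.
exists (1 + 3 * d), (1 + 3 * d'); split; last first.
  by move: dd'; rewrite !oddD /=; case: (odd d); case: (odd d').
  apply/mem_classesS; exists 3, (4 * 3 ^ j, d'); split => //=.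
  by congr (_, _); rewrite [3 ^ j.+1]expnS mulnCA.
apply/mem_classesS; exists 3, (2 * 3 ^ j.+1, d); split => //=.
by congr (_, _); rewrite [3 ^ j.+2]expnS mulnCA.
Qed.

(** With multipliers 2 and 3 only and [n] odd, there is a strict gain on the
    fibres of exact 3-adic valuation [j - 1]: the classes of moduli
    [2 * 3 ^ (j - 1)] and [4 * 3 ^ (j - 2)] are nested when they pass
    through 0 (on such a fibre), and disjoint when [n] is odd. *)
Lemma fibre_gain (j M n : nat) : 0 < M -> odd n ->
  (forall c, c \in classes 3 j.+2 -> c.1 %| M) -> 3 ^ j.+2 %| M -> M`_2^' %| n ->
  exists d', forall y,
  \sum_(0 <= i < M`_2) (hit 3 j.+2 0 (i * M`_2^' + y) : nat) +
  \sum_(0 <= i < M`_2) (((3 ^ j.+1 %| i * M`_2^' + y) &&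
       ~~ (3 ^ j.+2 %| i * M`_2^' + y)) && (4 %| i * M`_2^' + y + n * d') : nat) <=
  \sum_(0 <= i < M`_2) (hit 3 j.+2 n (i * M`_2^' + y) : nat).
Proof.
move=> M0 nodd cM M3 Qn; have [d [d' [din d'in dd']]] := class3_pair j.
exists d' => y; set Q := M`_2^'; set E := M`_2.
have EQ : E * Q = M by exact: partnC.
have Q3 : 3 ^ j.+2 %| Q.
  by move: M3; rewrite -EQ Gauss_dvdr // coprimeXl // /E p_part coprimeXr.
have Q3' : 3 ^ j.+1 %| Q by apply: dvdn_trans Q3; rewrite dvdn_exp2l.
have yE i : (3 ^ j.+1 %| i * Q + y) && ~~ (3 ^ j.+2 %| i * Q + y) =
            (3 ^ j.+1 %| y) && ~~ (3 ^ j.+2 %| y).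
  by rewrite !(dvdn_addr y) // dvdn_mull.
under [X in _ + X <= _]eq_bigr do rewrite yE.
case: andP => [[y1 y2]|_]; last first.
  by rewrite [X in _ + X]big1 // addn0; apply: fibre_le.
have le0 : \sum_(0 <= i < E) (hit 3 j.+2 0 (i * Q + y) : nat) <=
           \sum_(0 <= i < E) (2 * 3 ^ j.+1 %| i * Q + y : nat).
  apply: leq_sum => i _; case hi: (hit 3 _ 0 _) => //.
  case/hasP: hi => c cin; rewrite mul0n addn0 => h.
  have /andP[r1 r2] : (3 ^ j.+1 %| i * Q + y) && ~~ (3 ^ j.+2 %| i * Q + y).
    by rewrite yE y1.
  rewrite Gauss_dvd ?coprimeXr // r1 andbT.
  have /orP[c3|c2] := class3_dvd cin; last by rewrite (dvdn_trans c2 h).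
  by rewrite (dvdn_trans c3 h) in r2.
apply: (leq_trans (leq_add le0 (leqnn _))).
rewrite -(sum_fibre_shift y d _ Qn) ?EQ; last exact: (cM _ din).
rewrite -big_split /=; apply: leq_sum => i _; set r := i * Q + y.
have h1 : 2 * 3 ^ j.+1 %| r + n * d -> hit 3 j.+2 n r by exact: (hit_class din).
have h2 : 4 %| r + n * d' -> hit 3 j.+2 n r.
  move=> h4; apply: (hit_class d'in); rewrite /= Gauss_dvd ?h4 /=; last first.
    by rewrite coprimeXr.
  have j3 : 3 ^ j %| 3 ^ j.+1 by rewrite dvdn_exp2l.
  have nr : 3 ^ j %| n by exact: dvdn_trans j3 (dvdn_trans Q3' Qn).
  apply: dvdn_add; last exact: dvdn_mulr.
  by apply: dvdn_add; [rewrite dvdn_mull // (dvdn_trans j3) | exact: dvdn_trans y1].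
have h12 : 2 * 3 ^ j.+1 %| r + n * d -> 4 %| r + n * d' -> False.
  clearbody r; move=> /(dvdn_trans (dvdn_mulr _ (dvdnn 2))) + /(dvdn_trans (isT : 2 %| 4)).
  rewrite !dvdn2 !oddD !oddM nodd /=.
  by move: dd'; case: (odd r); case: (odd d); case: (odd d').
move: h1 h2 h12; case: (_ %| _); case: (4 %| _); case: (hit _ _ _ _) => //= a b c.
- by case: c.
- by have := a isT.
- by have := a isT.
- by have := b isT.
Qed.

Lemma gain_count (j M n d' : nat) : 4 * 3 ^ j.+2 %| M ->
  2 * 3 ^ j.+2 * (\sum_(0 <= r < M)
    (((3 ^ j.+1 %| r) && ~~ (3 ^ j.+2 %| r)) && (4 %| r + n * d') : nat)) = M.
Proof.
move=> M4.
have c3 k : coprime (3 ^ k) 4 by rewrite coprimeXl.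
have p3 k : 0 < 3 ^ k * 4 by rewrite muln_gt0 expn_gt0.
have d1 : 3 ^ j.+2 * 4 %| M by rewrite mulnC.
have d2 : 3 ^ j.+1 * 4 %| M.
  by apply: dvdn_trans d1; rewrite dvdn_mul // dvdn_exp2l.
have := sum_class2 0 (n * d') (c3 j.+1) (p3 j.+1) d2.
have := sum_class2 0 (n * d') (c3 j.+2) (p3 j.+2) d1.
set A := \sum_(_ <= _ < _) _ => eA; set B := \sum_(_ <= _ < _) _ => eB.
set G := \sum_(_ <= _ < _) _.
have : G + A = B.
  rewrite -big_split /=; apply: eq_bigr => r _; rewrite !addn0.
  have : 3 ^ j.+2 %| r -> 3 ^ j.+1 %| r.
    by apply: dvdn_trans; rewrite dvdn_exp2l.
  case: (3 ^ j.+2 %| r) => [/(_ isT) ->|_] //=.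
  by rewrite andbT addn0.
move/(congr1 (muln (3 ^ j))); rewrite mulnDr; move: (divnK d1) (divnK d2).
by rewrite -eA -eB !expnS; lia.
Qed.

Lemma hit_dvd (s j n r : nat) : (forall c, c \in classes s j -> c.1 %| n) ->
  hit s j n r = hit s j 0 r.
Proof.
move=> cn; apply: eq_in_has => c /cn h.
by rewrite mul0n addn0 dvdn_addl // dvdn_mulr.
Qed.

Lemma sum_fibres2 (f : nat -> nat) (M : nat) : 0 < M ->
  \sum_(0 <= r < M) f r =
  \sum_(0 <= y < M`_2^') \sum_(0 <= i < M`_2) f (i * M`_2^' + y).
Proof. by move=> M0; rewrite -sum_fibres partnC. Qed.

Lemma period_le (s j M n : nat) : 0 < M ->
  (forall c, c \in classes s j -> c.1 %| M) -> M`_2^' %| n ->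
  \sum_(0 <= r < M) (hit s j 0 r : nat) <= \sum_(0 <= r < M) (hit s j n r : nat).
Proof.
move=> M0 cM Qn; rewrite !(sum_fibres2 _ M0).
by apply: leq_sum => y _; exact: fibre_le.
Qed.

Lemma period_gain (j M n : nat) : 1 < j -> 0 < M -> odd n ->
  (forall c, c \in classes 3 j -> c.1 %| M) -> 4 * 3 ^ j %| M -> M`_2^' %| n ->
  2 * 3 ^ j * \sum_(0 <= r < M) (hit 3 j 0 r : nat) + M <=
  2 * 3 ^ j * \sum_(0 <= r < M) (hit 3 j n r : nat).
Proof.
case: j => [|[|j]] // _ M0 nodd cM M4 Qn.
have M3 : 3 ^ j.+2 %| M := dvdn_trans (dvdn_mull 4 (dvdnn _)) M4.
have [d' gain] := fibre_gain M0 nodd cM M3 Qn.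
rewrite -[X in _ + X <= _](gain_count n d' M4) -mulnDr leq_mul2l; apply/orP; right.
rewrite !(sum_fibres2 _ M0) -big_split.
by apply: leq_sum => y _; exact: gain.
Qed.

Lemma fact_modulus (j K : nat) : 1 < j -> 2 < K ->
  [/\ 0 < K`! ^ j, 4 * 3 ^ j %| K`! ^ j &
      forall s c, s <= K -> c \in classes s j -> c.1 %| K`! ^ j].
Proof.
move=> j1 K2; split; first by rewrite expn_gt0 fact_gt0.
  apply: (@dvdn_trans ((2 * 3) ^ j)).
    by rewrite expnMn dvdn_pmul2r ?expn_gt0 // (dvdn_exp2l 2 j1).
  by rewrite dvdn_exp2r // Gauss_dvd // !dvdn_fact // (ltnW K2).
move=> s c sK; apply: classes_dvd => u /andP[u1 us].
by rewrite dvdn_fact // (leq_trans us sK) andbT ltnW.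
Qed.

(** Take [n0 = N M] and [n1 = n0 + Q], with [Q] the odd part of [M].  On the
    block [[i M, i M + M)] the multipliers allowed for [n0] are bounded by the
    ceiling of [N / i], and all of them remain allowed for [n1] on the previous
    block, where [r] is smaller: the two sets can be compared block by block,
    without following the endpoints of the windows.  The first [6 x] blocks,
    that is the [r] below [n0 / K], are given up in order to keep the
    multipliers at most [K], and the [K x] blocks [i] from [N / 3] to [N / 2],
    on which the ceiling is 3, give the gain. *)
Section BlockComparison.

Variables (j K x M : nat).
Hypotheses (j1 : 1 < j) (K2 : 2 < K) (x0 : 0 < x) (M0 : 0 < M).
Hypothesis M4 : 4 * 3 ^ j %| M.
Hypothesis cM : forall s c, s <= K -> c \in classes s j -> c.1 %| M.

Let N := 6 * K * x.
Let n0 := N * M.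
Let n1 := n0 + M`_2^'.

Let b n i := \sum_(i * M <= r < i.+1 * M) (r \in T j n : nat).
Let Z n s := \sum_(0 <= r < M) (hit s j n r : nat).

Let N_gt0 : 0 < N. Proof. by rewrite !muln_gt0 x0; lia. Qed.
Let n0_gt0 : 0 < n0. Proof. by rewrite muln_gt0 N_gt0. Qed.

Let Q_n1 : M`_2^' %| n1.
Proof. by rewrite dvdn_add // (dvdn_trans (dvdn_part _ _)) // dvdn_mull. Qed.

Let odd_n1 : odd n1.
Proof.
have : odd M`_2^' by rewrite odd_2'nat part_pnat.
by rewrite /n1 oddD => ->; rewrite /n0 /N !oddM.
Qed.

Let block_sum f i : (forall r, f (r + M) = f r) ->
  \sum_(i * M <= r < i.+1 * M) f r = \sum_(0 <= r < M) f r.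
Proof. by move=> fM; rewrite -[i.+1]addn1 mulnDl sum_periods // mul1n. Qed.

Let hit_periodM s n r : s <= K -> hit s j n (r + M) = hit s j n r.
Proof. by move=> sK; apply: eq_in_has => c cin; rewrite dvdn_period // (cM sK). Qed.

Let cut_le i : 6 * x <= i -> cut N i <= K.
Proof. by move=> xi; rewrite cutP /N; nia. Qed.

Let b0_le i : b n0 i <= M.
Proof.
rewrite /b -[leqRHS](_ : i.+1 * M - i * M = M); last by rewrite mulSn addnK.
by rewrite -[leqRHS]muln1 -sum_nat_const_nat leq_sum // => r _; exact: leq_b1.
Qed.

Let b0_leZ i : 6 * x <= i -> b n0 i <= Z 0 (cut N i).
Proof.
move=> xi; have i0 : 0 < i by lia.
rewrite /Z -(block_sum i) => [|r]; last by rewrite hit_periodM ?cut_le.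
rewrite /b !big_nat; apply: leq_sum => r /andP[ir _].
case rT : (r \in _) => //.
have h : hit (cut N i) j n0 r.
  apply: T_hit rT _; have /andP[Ni _] := cut_bounds N i0.
  apply: leq_trans (leq_mul Ni (leqnn M)) _.
  by rewrite -mulnA mulnCA leq_mul2l ir orbT.
rewrite -(hit_dvd (n := n0)) ?h // => c cin.
by rewrite dvdn_mull // (cM (cut_le xi)).
Qed.

Let Z_leb1 i : 6 * x <= i < N -> Z n1 (cut N i) <= b n1 i.-1.
Proof.
move=> /andP[xi iN]; have i0 : 0 < i by lia.
rewrite /Z -(block_sum i.-1) => [|r]; last by rewrite hit_periodM ?cut_le.
rewrite /b prednK // !big_nat; apply: leq_sum => r /andP[_ ri].
have s1 : 1 < cut N i by rewrite ltnNge cutP // muln1 -ltnNge.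
case h : (hit _ _ _ _) => //; rewrite (hit_T _ s1 _ _ h) //.
- by rewrite (leq_trans n0_gt0) ?leq_addr.
- have : (cut N i).-1 * i < N by rewrite mulnC ltnNge -cutP // -ltnNge; lia.
  move=> lt; apply: leq_trans (leq_addr _ _).
  apply: leq_ltn_trans (_ : (cut N i).-1 * (i * M) < _).
    by rewrite leq_mul2l (ltnW ri) orbT.
  by rewrite mulnA ltn_mul2r M0.
- by rewrite addn_gt0 (ltnW j1) orbT.
Qed.

Let Z_le s : s <= K -> Z 0 s <= Z n1 s.
Proof. by move=> sK; apply: period_le => // c; exact: cM. Qed.

Let Z_gain : 2 * 3 ^ j * Z 0 3 + M <= 2 * 3 ^ j * Z n1 3.
Proof. by apply: period_gain => // c; exact: cM. Qed.

Lemma t_block_comparison :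
  2 * 3 ^ j * t j n0 + K * x * M <= 2 * 3 ^ j * (t j n1 + 6 * x * M).
Proof.
set w := 2 * 3 ^ j.
have xN : 6 * x <= N by rewrite /N; nia.
have t0 : t j n0 <= 6 * x * M + \sum_(6 * x <= i < N) b n0 i.
  rewrite t_sum (big_nat_mul _ N M) (@big_cat_nat _ _ _ (6 * x)) //= leq_add2r.
  apply: (@leq_trans (\sum_(0 <= i < 6 * x) M)); last first.
    by rewrite sum_nat_const_nat subn0.
  by apply: leq_sum => i _; exact: b0_le.
have t1 : \sum_(6 * x <= i < N) b n1 i.-1 <= t j n1.
  apply: (@leq_trans (\sum_(1 <= i < N) b n1 i.-1)).
    by rewrite [leqRHS](@big_cat_nat _ _ _ (6 * x)) ?leq_addl //; lia.
  apply: (@leq_trans (\sum_(0 <= i < N) b n1 i)).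
    by rewrite big_add1 -{2}(prednK N_gt0) big_nat_recr //= leq_addr.
  rewrite t_sum [leqRHS](@big_cat_nat _ _ _ n0) ?leq_addr //=.
  by rewrite (big_nat_mul _ N M) leq_addr.
have step i : 6 * x <= i < N ->
    w * b n0 i + ((2 * K * x <= i) && (i < 3 * K * x)) * M <= w * b n1 i.-1.
  move=> iI; have xi : 6 * x <= i by case/andP: iI.
  apply: leq_trans (leq_mul (leqnn w) (Z_leb1 iI)).
  apply: (@leq_trans (w * Z 0 (cut N i) +
      ((2 * K * x <= i) && (i < 3 * K * x)) * M)).
    by rewrite leq_add2r leq_mul2l b0_leZ ?orbT.
  case: andP => [[i2 i3]|_].
    suff -> : cut N i = 3 by rewrite mul1n; exact: Z_gain.
    apply/eqP; rewrite eqn_leq ltnNge !cutP ?/N -?ltnNge; lia.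
  by rewrite mul0n addn0 leq_mul2l Z_le ?orbT // cut_le.
have : \sum_(6 * x <= i < N)
    (w * b n0 i + ((2 * K * x <= i) && (i < 3 * K * x)) * M) <=
    \sum_(6 * x <= i < N) w * b n1 i.-1.
  by rewrite !big_nat; apply: leq_sum => i /step.
have gain : K * x * M <= \sum_(6 * x <= i < N)
    ((2 * K * x <= i) && (i < 3 * K * x)) * M.
  rewrite (@big_cat_nat _ _ _ (2 * K * x)) /=; [|nia|rewrite /N; nia].
  apply: leq_trans (leq_addl _ _).
  rewrite (@big_cat_nat _ _ _ (3 * K * x)) /=; [|nia|rewrite /N; nia].
  apply: leq_trans (leq_addr _ _).
  rewrite (eq_big_nat _ _ (F2 := fun=> M)) => [|i ->]; last by rewrite mul1n.
  by rewrite sum_nat_const_nat -mulnBl leq_mul2r; apply/orP; right; lia.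
rewrite big_split /= -!big_distrr /=.
move: t0 t1 gain; set S0 := \sum_(_ <= _ < _) _; set S1 := \sum_(_ <= _ < _) _.
set G := \sum_(_ <= _ < _) _; nia.
Qed.

End BlockComparison.
(** * The first iterate *)

Local Open Scope nat_scope.

Definition primorial (s : nat) : nat := \prod_(0 <= p < s.+1 | prime p) p.

Lemma primorialS (s : nat) :
  primorial s.+1 = if prime s.+1 then primorial s * s.+1 else primorial s.
Proof.
rewrite /primorial big_mkcond big_nat_recr //= -big_mkcond /=.
by case: (prime s.+1); rewrite ?muln1.
Qed.

Lemma primorial_gt0 (s : nat) : 0 < primorial s.
Proof. by apply: prodn_cond_gt0 => p; exact: prime_gt0. Qed.

Lemma hit1P (s n r : nat) :
  reflect (exists2 u, 2 <= u <= s & u %| r + n) (hit s 1 n r).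
Proof.
apply: (iffP (hitS _ _ _ _)) => [[u [us ur _]]|[u us ur]]; exists u => //.
by split => //; rewrite hit0.
Qed.

(** A divisor of [r + n] between 2 and [s] has a prime factor at most [s]. *)
Lemma hit1_coprime (s n r : nat) : hit s 1 n r = ~~ coprime (primorial s) (r + n).
Proof.
elim: s => [|s IH].
  rewrite /primorial big_mkcond big_nat1 /= coprime1n.
  by apply/hit1P => -[u]; lia.
have -> : hit s.+1 1 n r = hit s 1 n r || ((0 < s) && (s.+1 %| r + n)).
  apply/hit1P/orP => [[u us ur]|[/hit1P[u us ur]|/andP[s0 sr]]].
  - have [us'|us'] := leqP u s.
      by left; apply/hit1P; exists u => //; lia.
    have us1 : u = s.+1 by lia.
    by right; rewrite -us1 ur andbT; lia.
  - by exists u => //; lia.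
  - by exists s.+1 => //; lia.
rewrite IH primorialS; case: ifP => [ps|nps].
  rewrite coprimeMl negb_and (prime_coprime _ ps) negbK.
  by case: s ps {IH}.
apply/orP/idP => [[//|/andP[s0 sr]]|->]; last by left.
rewrite -IH; apply/hit1P; exists (pdiv s.+1).
  have pp : prime (pdiv s.+1) by rewrite pdiv_prime.
  have := dvdn_leq (ltn0Sn s) (pdiv_dvd s.+1); rewrite leq_eqVlt => /orP[/eqP e|].
    by rewrite e nps in pp.
  by rewrite prime_gt1 //= ltnS.
exact: dvdn_trans (pdiv_dvd _) sr.
Qed.

Lemma hit1_count (s n : nat) :
  \sum_(0 <= r < primorial s) (hit s 1 n r : nat) + totient (primorial s) =
  primorial s.
Proof.
set P := primorial s.
have coP x : coprime P (x + P) = coprime P x.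
  by rewrite /coprime gcdnDr.
have -> : totient P = \sum_(0 <= r < P) (coprime P (r + n) : nat).
  rewrite totient_count_coprime.
  by rewrite (sum_period_shift (f := fun x => coprime P x : nat)) // => x; rewrite coP.
rewrite -big_split /= (eq_bigr (fun=> 1)) => [|r _].
  by rewrite sum_nat_const_nat subn0 muln1.
by rewrite hit1_coprime; case: coprime.
Qed.

Local Open Scope ring_scope.

(** The density of the integers that have a prime factor at most [s]. *)
Definition sieved (R : realFieldType) (s : nat) : R :=
  1 - \prod_(0 <= p < s.+1 | prime p) (1 - 1 / p%:R).

Lemma totient_primorial (R : realFieldType) (s : nat) :
  (totient (primorial s))%:R =
  (primorial s)%:R * \prod_(0 <= p < s.+1 | prime p) (1 - 1 / p%:R) :> R.
Proof.
elim: s => [|s IH].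
  by rewrite /primorial !(big_mkcond prime) !big_nat1 /= mulr1.
rewrite primorialS [in RHS]big_mkcond big_nat_recr //= -big_mkcond /=.
have [ps|_] := boolP (prime s.+1); last by rewrite mulr1 IH.
rewrite totient_coprime; last first.
  rewrite -[s.+1]addn0 -[coprime _ _]negbK -hit1_coprime; apply/hit1P => -[u us].
  rewrite addn0 => /((primeP ps).2 u); lia.
rewrite (totient_prime ps) !natrM IH -!mulrA; congr (_ * _).
rewrite mulrCA; congr (_ * _) => /=.
by rewrite mulrBr mulr1 mul1r mulfV ?pnatr_eq0 // -(addn1 s) natrD addrK.
Qed.

Lemma sieved_01 (R : realFieldType) (s : nat) : 0 <= sieved R s <= 1.
Proof.
have P0 : (0 : R) < (primorial s)%:R by rewrite ltr0n primorial_gt0.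
rewrite /sieved; set x := \prod_(_ <= _ < _ | _) _.
have xE : (totient (primorial s))%:R = (primorial s)%:R * x by exact: totient_primorial.
have tle : (totient (primorial s) <= primorial s)%N.
  by rewrite -[leqRHS](hit1_count s 0) leq_addl.
have : 0 <= x by rewrite -(pmulr_rge0 _ P0) -xE.
have : x <= 1 by rewrite -(ler_pM2l P0) -xE mulr1 ler_nat.
by lra.
Qed.

Lemma hit1_sum (R : realFieldType) (s n a b : nat) : (a <= b)%N ->
  (b%:R - a%:R : R) * sieved R s - (primorial s)%:R
    <= (\sum_(a <= r < b) (hit s 1 n r : nat))%:R
    <= (b%:R - a%:R) * sieved R s + (primorial s)%:R.
Proof.
move=> ab; set P := primorial s.
have P0 : (0 < P)%N := primorial_gt0 s.
have P0' : (0 : R) < P%:R by rewrite ltr0n.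
have per r : hit s 1 n (r + P) = hit s 1 n r.
  by rewrite !hit1_coprime addnAC /coprime gcdnDr.
have := sum_period_bounds (f := fun r => hit s 1 n r : nat) P0
  (fun r => congr1 nat_of_bool (per r)) ab.
have := hit1_count s n; rewrite -/P.
set c := (\sum_(0 <= r < P) _)%N; set X := (\sum_(a <= r < b) _)%N => cE [lo hi].
have cR : c%:R = P%:R * sieved R s.
  rewrite /sieved mulrBr mulr1 -totient_primorial -/P.
  by apply/eqP; rewrite eq_sym subr_eq -natrD cE.
have /andP[s0 s1] := sieved_01 R s.
have cP : c%:R <= P%:R :> R by rewrite ler_nat -[leqRHS]cE leq_addr.
move: lo hi; rewrite -!(ler_nat R) !(natrM, natrD) natrB // cR => lo hi.
rewrite -(ler_pM2l P0') -[X in _ && X](ler_pM2l P0').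
have pp : 0 <= P%:R * P%:R * (1 - sieved R s) by rewrite mulr_ge0 ?subr_ge0.
by apply/andP; split; lra.
Qed.

Lemma t1_approx (R : realType) (S : nat) : (0 < S)%N ->
  exists C : R, forall n, (0 < n)%N ->
    n%:R * (\sum_(2 <= s < S.+1) t1_summand R s) - C <= (t 1 n)%:R
      <= n%:R * (\sum_(2 <= s < S.+1) t1_summand R s + S%:R^-1) + C.
Proof.
move=> S0; exists (1 + \sum_(2 <= s < S.+1) (1 + (primorial s)%:R)) => n n0.
rewrite (t_cut n0 S0) // natrD.
set X := (\sum_(0 <= _ < _) _)%N; rewrite natr_sum; set Y := \sum_(_ <= _ < _) _%:R.
set B := \sum_(_ <= _ < _) _; set D := \sum_(_ <= _ < _) _.
have X0 : (0 : R) <= X%:R by [].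
have X1 : X%:R <= n%:R / S%:R + 1 :> R.
  apply: le_trans (cut_real R n S0).2; rewrite ler_nat.
  rewrite /X -[leqRHS]subn0 -[leqRHS]muln1 -sum_nat_const_nat leq_sum // => r _.
  exact: leq_b1.
suff : n%:R * B - D <= Y <= n%:R * B + D.
  by case/andP => lo hi; apply/andP; split; lra.
suff win s : (2 <= s < S.+1)%N ->
  n%:R * t1_summand R s - (1 + (primorial s)%:R) <=
  (\sum_(cut n s <= r < cut n s.-1) (hit s 1 n r : nat))%:R <=
  n%:R * t1_summand R s + (1 + (primorial s)%:R).
  rewrite mulr_sumr -sumrB -big_split /Y !big_nat.
  by apply/andP; split; apply: ler_sum => s /win /andP[].
move=> /andP[s1 sS]; have s0 : (0 < s)%N by lia.
have sp0 : (0 < s.-1)%N by lia.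
have cc : (cut n s <= cut n s.-1)%N by rewrite leq_cut //; lia.
have spE : s.-1%:R = s%:R - 1 :> R by rewrite -subn1 natrB.
have s2 : (2 : R) <= s%:R by rewrite ler_nat.
have := cut_real R n s0; have := cut_real R n sp0; rewrite spE => -[a1 a2] [b1 b2].
have /andP[v0 v1] := sieved_01 R s.
have := hit1_sum R s n cc; set l := (cut n s.-1)%:R - (cut n s)%:R.
set Z := (\sum_(_ <= _ < _) _)%N%:R.
move=> /andP[lo hi].
have lE : n%:R / (s%:R * (s%:R - 1)) = n%:R / (s%:R - 1) - n%:R / s%:R :> R.
  by field; rewrite !gt_eqF //; lra.
have -> : n%:R * t1_summand R s = n%:R / (s%:R * (s%:R - 1)) * sieved R s.
  by rewrite /t1_summand mul1r mulrA.
have l1 : l <= n%:R / (s%:R * (s%:R - 1)) + 1 by rewrite lE /l; lra.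
have l2 : n%:R / (s%:R * (s%:R - 1)) - 1 <= l by rewrite lE /l; lra.
have := ler_wpM2r v0 l1; have := ler_wpM2r v0 l2 => h1 h2.
by apply/andP; split; lra.
Qed.

Lemma t1_summand_bound (R : realType) (s : nat) : (1 < s)%N ->
  0 <= t1_summand R s <= (s%:R - 1)^-1 - s%:R^-1.
Proof.
move=> s1; have s2 : (2 : R) <= s%:R by rewrite ler_nat.
have -> : (s%:R - 1)^-1 - s%:R^-1 = (s%:R * (s%:R - 1))^-1 :> R.
  by field; rewrite !gt_eqF //; lra.
have /andP[v0 v1] := sieved_01 R s; rewrite /t1_summand mul1r.
have p0 : 0 <= (s%:R * (s%:R - 1))^-1 :> R by rewrite invr_ge0; nra.
by rewrite mulr_ge0 //= ler_piMr.
Qed.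

Lemma t1_partial_tail (R : realType) (S S' : nat) : (0 < S <= S')%N ->
  \sum_(2 <= s < S'.+1) t1_summand R s <=
  \sum_(2 <= s < S.+1) t1_summand R s + S%:R^-1 - S'%:R^-1.
Proof.
case/andP => S0 /subnK <-; elim: (S' - S)%N => [|k IH]; first by rewrite add0n addrK.
rewrite addSn big_nat_recr ?addn_gt0 ?S0 ?orbT //=; last by lia.
have k1 : (1 < (k + S).+1)%N by lia.
have e : (k + S).+1%:R - 1 = (k + S)%:R :> R by rewrite -natr1 addrK.
have /andP[_] := t1_summand_bound R k1; rewrite e => h.
by apply: le_trans (lerD IH h) _; rewrite addrA subrK.
Qed.

(** Summation by parts: [1 / (s (s - 1)) = 1 / (s - 1) - 1 / s], and [sieved]
    jumps only at primes. *)
Lemma t1_abel (R : realType) (N : nat) : (0 < N)%N ->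
  \sum_(0 <= p < N.+1 | prime p) t1_prime_summand R p =
  \sum_(2 <= s < N.+1) t1_summand R s + sieved R N / N%:R.
Proof.
case: N => // N _; elim: N => [|N IH].
  rewrite [in RHS]big_geq // /sieved.
  rewrite big_mkcond !big_nat_recr //= big_geq //.
  rewrite [in RHS]big_mkcond !big_nat_recr //= big_geq //.
  by rewrite !mulr1 !addr0 subrr mul0r addr0.
rewrite big_mkcond big_nat_recr //= -big_mkcond /= IH [in RHS]big_nat_recr //=.
rewrite -!addrA; congr (_ + _).
have -> : t1_summand R N.+2 = 1 / (N.+2%:R * (N.+2%:R - 1)) * sieved R N.+2 by [].
have n0 : N.+1%:R != 0 :> R by rewrite pnatr_eq0.
have n1 : N.+1%:R + 1 != 0 :> R by rewrite natr1 pnatr_eq0.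
rewrite /t1_prime_summand /sieved [in RHS]big_mkcond big_nat_recr //= -big_mkcond /=.
rewrite -[N.+2%:R]natr1 addrK; set P := \prod_(_ <= _ < _ | _) _.
move: n0 n1; set x := N.+1%:R; clearbody x P => n0 n1.
by case: (prime N.+2); field; rewrite n0 n1.
Qed.
(** * Upper and lower limits *)

Local Open Scope classical_set_scope.
Local Open Scope ring_scope.

Lemma limn_esup_leP (R : realType) (u : R^nat) (B : R) :
  (limn_esup (fun n => (u n)%:E) <= B%:E)%E <->
  forall e, 0 < e -> exists N, forall n, (N <= n)%N -> u n <= B + e.
Proof.
split=> [uB e e0|uB].
  have : (limn_esup (fun n => (u n)%:E) < (B + e)%:E)%E.
    by apply: le_lt_trans uB _; rewrite lte_fin ltrDl.
  case/ereal_inf_lt => _ [V [N _ NV] <-] supV; exists N => n Nn.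
  rewrite -lee_fin; apply: le_trans (ltW supV).
  by apply: ereal_sup_ubound; exists n => //; exact: NV.
apply/lee_addgt0Pr => e /uB[N uN].
pose V := [set n | (N <= n)%N].
apply: (@le_trans _ _ (ereal_sup ((fun n => (u n)%:E) @` V))).
  by apply: ereal_inf_lbound; exists V => //; exists N.
by apply: ge_ereal_sup => _ [n Nn <-]; rewrite -EFinD lee_fin; exact: uN.
Qed.

Lemma limn_einf_geP (R : realType) (u : R^nat) (B : R) :
  (B%:E <= limn_einf (fun n => (u n)%:E))%E <->
  forall e, 0 < e -> exists N, forall n, (N <= n)%N -> B - e <= u n.
Proof.
have -> : limn_einf (fun n => (u n)%:E) =
    (- limn_esup (fun n => (- u n)%:E))%E by [].
rewrite leeNr; split=> [/(limn_esup_leP (fun n => - u n)) h e /h[N uN]|h].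
  by exists N => n /uN; lra.
apply/(limn_esup_leP (fun n => - u n)) => e /h[N uN].
by exists N => n /uN; lra.
Qed.

Lemma exists_nat_above (R : realType) (x : R) :
  exists N, (0 < N)%N /\ forall n, (N <= n)%N -> x <= n%:R.
Proof.
exists (Num.truncn x).+1; split=> // n Nn.
by rewrite (le_trans (ltW (truncnS_gt x))) // ler_nat.
Qed.

Section Oscillation.

Variables (R : realType) (u : R^nat) (c : R).
Hypothesis u_pairs :
  forall N, exists n m, [/\ (N <= n)%N, (N <= m)%N & c <= u n - u m].

Lemma oscillation_not_cvgn : 0 < c -> ~ cvgn u.
Proof.
move=> c0 /cvgrPdist_lt/(_ (c / 2)); rewrite divr_gt0 // => /(_ isT)[N _ uN].
have [n [m [/uN + /uN]]] := u_pairs N; rewrite /= !ltr_norml.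
by move=> /andP[a1 a2] /andP[b1 b2]; lra.
Qed.

Lemma oscillation_limn : (forall n, 0 <= u n <= 1) ->
  (c%:E <= limn_esup (fun n => (u n)%:E) - limn_einf (fun n => (u n)%:E))%E.
Proof.
move=> u01; set ls := limn_esup _; set li := limn_einf _.
have ls1 : (ls <= 1%:E)%E.
  by apply/limn_esup_leP => e e0; exists 0%N => n _; have := u01 n; lra.
have li0 : (0%:E <= li)%E.
  by apply/limn_einf_geP => e e0; exists 0%N => n _; have := u01 n; lra.
have lils : (li <= ls)%E by exact: limn_einf_sup.
have lsfin : ls \is a fin_num.
  by rewrite ge0_fin_numE ?(le_lt_trans ls1) ?ltry // (le_trans li0).
have lifin : li \is a fin_num.
  by rewrite ge0_fin_numE // (le_lt_trans lils) // (le_lt_trans ls1) ?ltry.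
rewrite -(fineK lsfin) -(fineK lifin) -EFinB lee_fin.
have := lexx ls; rewrite -{2}(fineK lsfin) => /limn_esup_leP hs.
have := lexx li; rewrite -{1}(fineK lifin) => /limn_einf_geP hi.
apply/ler_addgt0Pr => e e0; have e2 : 0 < e / 2 by rewrite divr_gt0.
have [N1 h1] := hs _ e2; have [N2 h2] := hi _ e2.
have [n [m []]] := u_pairs (maxn N1 N2).
by rewrite !geq_max => /andP[/h1 a1 _] /andP[_ /h2 a2]; lra.
Qed.

End Oscillation.

(** * The density of the iterates *)

Lemma density_01 (R : realType) (j n : nat) : 0 <= density R j n <= 1.
Proof.
rewrite /density divr_ge0 //=; case: n => [|n]; first by rewrite invr0 mulr0.
by rewrite ler_pdivrMr ?ltr0n // mul1r ler_nat t_le.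
Qed.

Lemma limsup_density_le (R : realType) (j : nat) (B C : R) :
  (forall n, (0 < n)%N -> (t j n)%:R <= n%:R * B + C) ->
  (limsup_density R j <= B%:E)%E.
Proof.
move=> h; apply/limn_esup_leP => e e0.
have [N [N0 hN]] := exists_nat_above (C / e); exists N => n Nn.
have n0 : (0 < n)%N by exact: leq_trans Nn.
rewrite /density ler_pdivrMr ?ltr0n //; apply: le_trans (h n n0) _.
have := hN n Nn; rewrite ler_pdivrMr //; lra.
Qed.

Lemma liminf_density_ge (R : realType) (j : nat) (B C : R) :
  (forall n, (0 < n)%N -> n%:R * B - C <= (t j n)%:R) ->
  (B%:E <= liminf_density R j)%E.
Proof.
move=> h; apply/limn_einf_geP => e e0.
have [N [N0 hN]] := exists_nat_above (C / e); exists N => n Nn.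
have n0 : (0 < n)%N by exact: leq_trans Nn.
rewrite /density ler_pdivlMr ?ltr0n //; apply: le_trans (h n n0).
have := hN n Nn; rewrite ler_pdivrMr //; lra.
Qed.

(** The blocks given up cost [6 x M] and the gain is [K x M / (2 * 3 ^ j)],
    which is [24 x M] for [K = 48 * 3 ^ j].  The difference [18 x M] is
    [n0 / (16 * 3 ^ j)]; the margin over [n0 / (24 * 3 ^ j)] absorbs the change
    of denominator from [n0] to [n1]. *)
Lemma density_oscillation (R : realType) (j : nat) : (1 < j)%N -> forall N,
  exists n m, [/\ (N <= n)%N, (N <= m)%N &
    1 / (24 * 3 ^+ j) <= density R j n - density R j m].
Proof.
move=> j1 N; pose K := (48 * 3 ^ j)%N.
have X0 : (0 < 3 ^ j)%N by rewrite expn_gt0.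
have K2 : (2 < K)%N by rewrite /K; lia.
have [M0 M4 cM] := fact_modulus j1 K2.
move: (K`! ^ j)%N M0 M4 cM => M M0 M4 cM; pose x := N.+1.
have := t_block_comparison (x := x) j1 K2 isT M0 M4 cM.
set m := (6 * K * x * M)%N; set Q := (M`_2^')%N => comp.
have QM : (Q <= M)%N by rewrite dvdn_leq // dvdn_part.
have tt : (t j m + 18 * x * M <= t j (m + Q))%N by move: comp; rewrite /K; nia.
have mE : (m = 288 * 3 ^ j * x * M)%N by rewrite /m /K; lia.
have Nm : (N <= m)%N by rewrite mE /x; nia.
clear comp; clearbody m Q.
exists (m + Q)%N, m; split => //; first exact: leq_trans (leq_addr _ _).
have m0 : (0 < m)%N by rewrite mE !muln_gt0 X0.
have tm := t_le j m.
have x1 : (1 : R) <= x%:R by rewrite ler1n.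
rewrite lerBrDr /density ler_pdivlMr ?ltr0n ?addn_gt0 ?m0 //.
have M0' : (0 : R) < M%:R by rewrite ltr0n.
have Q0 : (0 : R) <= Q%:R by [].
have m0' : (0 : R) < m%:R by rewrite ltr0n.
have X1 : (1 : R) <= 3 ^+ j by rewrite exprn_ege1 // ler1n.
move: tt QM tm (congr1 (fun k => k%:R : R) mE); clear -x1 M0' Q0 m0' X1.
move: (t j m) (t j (m + Q)) => a b.
rewrite -!(ler_nat R) /= !(natrM, natrD, natrX).
set X := 3 ^+ j in X1 * => tt QM tm mE; have X0 : 0 < X by lra.
have am : a%:R / m%:R <= 1 :> R by rewrite ler_pdivrMr // mul1r.
have -> : (1 / (24 * X) + a%:R / m%:R) * (m%:R + Q%:R) =
   m%:R / (24 * X) + Q%:R / (24 * X) + a%:R + a%:R / m%:R * Q%:R.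
  by field; rewrite !gt_eqF.
have -> : m%:R / (24 * X) = 12 * x%:R * M%:R.
  by rewrite mE; field; rewrite !gt_eqF.
have q1 : Q%:R / (24 * X) <= Q%:R by rewrite ler_pdivrMr ?mulr_gt0 //; nra.
have q2 := ler_wpM2r Q0 am.
have xM : M%:R <= x%:R * M%:R :> R by rewrite ler_peMl // ltW.
by lra.
Qed.

(** With [B] the claimed bound, [B ^ 2 = 4 / 2 ^ (j + 1)].  The choice
    of [S] just above [2 / B] makes each of the two terms of [t_upper] at most
    [B / 2]. *)
Lemma limsup_density_powR (R : realType) (j : nat) : (0 < j)%N ->
  (limsup_density R j <= (2 `^ (- ((j%:R - 1) / 2)))%:E)%E.
Proof.
case: j => // j _; set B := _ `^ _.
have B0 : 0 < B by rewrite powR_gt0.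
have B2 : B * B = 4 / 2 ^+ j.+2.
  rewrite /B -powRD ?pnatr_eq0 ?implybT //.
  rewrite (_ : _ + _ = - j%:R); last by rewrite -natr1; field.
  rewrite powRN powR_mulrn // !exprS; field.
  by rewrite expf_neq0.
pose S := (Num.truncn (2 / B)).+1.
have [C hC] := @t_upper R j.+1 S isT isT.
apply: (@limsup_density_le _ _ _ C) => n n0; apply: le_trans (hC n n0) _.
rewrite lerD2r ler_wpM2l //.
have b0 : 0 <= 2 / B by rewrite divr_ge0 // ltW.
have /andP[S1 S2] := truncn_itv b0.
have i1 : S%:R^-1 <= B / 2.
  rewrite -div1r ler_pdivrMr ?ltr0n //.
  by move: S2; rewrite -/S ltr_pdivrMr //; lra.
have S3 : S%:R - 1 <= 2 / B by rewrite /S -natr1 addrK.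
have i2 : (S%:R - 1) / 2 ^+ j.+2 <= B / 2.
  have -> : B / 2 = 2 / B / 2 ^+ j.+2.
    have -> : (2 ^+ j.+2)^-1 = B * B / 4 by rewrite B2; field; rewrite expf_neq0.
    by field; rewrite gt_eqF.
  by rewrite ler_wpM2r // invr_ge0 exprn_ge0.
by lra.
Qed.

(** * The density of the first iterate *)

Lemma t1_partial_mono (R : realType) :
  nondecreasing_seq (fun N => \sum_(2 <= s < N) t1_summand R s).
Proof.
apply/nondecreasing_seqP => N; have [N2|N2] := ltnP N 2.
  by rewrite !big_geq // ltnW.
by rewrite [leRHS]big_nat_recr //= lerDl; have /andP[] := t1_summand_bound R N2.
Qed.

Lemma t1_cvgn (R : realType) : cvgn (fun N => \sum_(2 <= s < N) t1_summand R s).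
Proof.
apply: nondecreasing_is_cvgn; first exact: t1_partial_mono.
exists 1 => _ [N _ <-]; have [N2|] := leqP N 2; first by rewrite big_geq.
case: N => // N N2; have := @t1_partial_tail R 1 N (ltnW N2);
rewrite [X in _ <= X + _ - _]big_geq // add0r invr1.
by move=> h; apply: le_trans h _; rewrite gerBl invr_ge0.
Qed.

Lemma t1_lim_bounds (R : realType) (S : nat) : (0 < S)%N ->
  \sum_(2 <= s < S.+1) t1_summand R s <=
    limn (fun N => \sum_(2 <= s < N) t1_summand R s) <=
  \sum_(2 <= s < S.+1) t1_summand R s + S%:R^-1.
Proof.
move=> S0; have nd := @t1_partial_mono R.
apply/andP; split; first exact: (nondecreasing_cvgn_le nd (@t1_cvgn R) S.+1).
apply: limr_le; first exact: t1_cvgn.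
exists S.+1 => // -[//|S'] /= SS'.
have := @t1_partial_tail R S S'; rewrite S0 => /(_ SS') h.
by apply: le_trans h _; rewrite gerBl invr_ge0.
Qed.

(** For fixed [S] the densities are eventually within about [1 / S] of the
    partial sum up to [S], which is itself within [1 / S] of the limit. *)
Lemma density1_cvg (R : realType) :
  density R 1 @ \oo --> limn (fun N => \sum_(2 <= s < N) t1_summand R s).
Proof.
set L := limn _; apply/cvgrPdist_le => e e0.
have [S [S0 hS]] := exists_nat_above (2 / e).
have [C hC] := t1_approx R S0.
have [N [N0 hN]] := exists_nat_above (2 * C / e).
exists N => // n /= Nn; have n0 : (0 < n)%N by exact: leq_trans Nn.
have n0' : (0 : R) < n%:R by rewrite ltr0n.
have := hC n n0; have := t1_lim_bounds R S0; rewrite -/L.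
set B := \sum_(_ <= _ < _) _ => /andP[L1 L2] /andP[a1 a2].
have Se : S%:R^-1 <= e / 2.
  rewrite -div1r ler_pdivrMr ?ltr0n //.
  by have := hS S (leqnn S); rewrite ler_pdivrMr //; lra.
have Cn : C <= e / 2 * n%:R by have := hN n Nn; rewrite ler_pdivrMr //; lra.
have d1 : B - e / 2 <= density R 1 n.
  by rewrite /density ler_pdivlMr //; lra.
have d2 : density R 1 n <= B + S%:R^-1 + e / 2.
  by rewrite /density ler_pdivrMr //; lra.
by rewrite ler_norml; apply/andP; split; lra.
Qed.

Lemma t1_prime_cvg (R : realType) :
  (fun N => \sum_(0 <= p < N | prime p) t1_prime_summand R p) @ \oo -->
  limn (fun N => \sum_(2 <= s < N) t1_summand R s).
Proof.
set L := limn _; rewrite -(cvg_shiftS _ (nbhs L)) -(cvg_shiftS _ (nbhs L)).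
pose u N := \sum_(2 <= s < N) t1_summand R s.
have -> : [sequence \sum_(0 <= p < n.+2 | prime p) t1_prime_summand R p]_n =
    [sequence u n.+2]_n \+ [sequence sieved R n.+1 / n.+1%:R]_n.
  by apply/funext => n; exact: t1_abel.
rewrite -[L]addr0; apply: cvgD.
  have : u @ \oo --> L by exact: t1_cvgn.
  by rewrite -(cvg_shiftS u) -(cvg_shiftS (fun n => u n.+1)).
apply: (@squeeze_cvgr _ _ _ _ (cst 0) (@harmonic R)); last exact: cvg_harmonic.
  apply: nearW => n /=; have /andP[s0 s1] := sieved_01 R n.+1.
  by rewrite divr_ge0 //= /harmonic ler_pdivrMr // mulVf ?pnatr_eq0.
exact: cvg_cst.
Qed.

Theorem theorem1p4 (R : realType) :
  (forall j : nat, (2 <= j)%N ->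
    [/\ ((1 / (24 * 3 ^+ j))%:E <= DeltaE R j)%E,
        ~ cvgn (density R j),
        ((3 / 2 ^+ j.+1 - 1 / (2 * 3 ^+ j))%:E <= liminf_density R j)%E,
        (liminf_density R j <= limsup_density R j)%E
      & (limsup_density R j <= (2 `^ (- ((j%:R - 1) / 2)))%:E)%E]) /\
  [/\ cvgn (fun N => \sum_(2 <= s < N) t1_summand R s),
      cvgn (fun N => \sum_(0 <= p < N | prime p) t1_prime_summand R p),
      density R 1 @ \oo --> \big[+%R/0]_(2 <= s <oo) t1_summand R s
    & \big[+%R/0]_(2 <= s <oo) t1_summand R s =
      \big[+%R/0]_(0 <= p <oo | prime p) t1_prime_summand R p].
Proof.
split=> [j j2|]; last first.
  split; [exact: t1_cvgn | | exact: density1_cvg |].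
    by apply: cvgP; exact: t1_prime_cvg.
  by apply/esym/cvg_lim => //; exact: t1_prime_cvg.
have j0 : (0 < j)%N by exact: ltnW.
split.
- by apply: oscillation_limn; [exact: density_oscillation | exact: density_01].
- apply: oscillation_not_cvgn; first exact: density_oscillation.
  by rewrite divr_gt0 // mulr_gt0 // exprn_gt0.
- by have [C hC] := @t_lower R j j0; exact: liminf_density_ge hC.
- exact: limn_einf_sup.
- exact: limsup_density_powR.
Qed.
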